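(* Let $\mathbb{K}=\mathbb{R}$ or $\mathbb{C}$, let $A\in\mathbb{K}^{m\times n}$ be a matrix of rank $r$, let $\lambda_1>\cdots>\lambda_p>0$ be the distinct positive eigenvalues of $A^*A$, and let $m_i=\dim\{v\in\mathbb{K}^n\mid A^*Av=\lambda_iv\}$ for $i=1,\ldots,p$. Then the singular value decompositions of $A$ are parametrized by the points of the group $$U(m_1,\mathbb{K})\times\cdots\times U(m_p,\mathbb{K})\times U(n-r,\mathbb{K})\times U(m-r,\mathbb{K}).$$ That is, fixing one singular value decomposition $A=\overline{U}\Sigma\overline{V}^*$ with positive singular values $\sigma_1\ge\cdots\ge\sigma_r$, the map sending $(Q_1,\ldots,Q_p,Q_{\mathcal{N}},Q_{\mathcal{N}^*})$ to the triple $(U,\Sigma,V)$ defined by $$V=\overline{V}\operatorname{diag}(Q_1,\ldots,Q_p,Q_{\mathcal{N}}),\quad U_{:,1:r}=AV_{:,1:r}\big(\operatorname{diag}(\sigma_1,\ldots,\sigma_r)\big)^{-1},\quad U_{:,(r+1):m}=\overline{U}_{:,(r+1):m}Q_{\mathcal{N}^*}$$ is a bijection from this group onto the set of all singular value decompositions of $A$.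
   Context: $M^*$ is the conjugate transpose. $U(d,\mathbb{K})$ is the group of $d\times d$ unitary matrices over $\mathbb{K}$ (orthogonal matrices if $\mathbb{K}=\mathbb{R}$), trivial for $d=0$. A singular value decomposition of $M\in\mathbb{K}^{m\times n}$ of rank $r$ is a triple $(U,\Sigma,V)$ with $M=U\Sigma V^*$, $U\in\mathbb{K}^{m\times m}$, $V\in\mathbb{K}^{n\times n}$ unitary and $\Sigma=\operatorname{diag}(\sigma_1,\ldots,\sigma_r,0,\ldots,0)\in\mathbb{R}^{m\times n}$ with $\sigma_1\ge\cdots\ge\sigma_r>0$. $M_{:,s:t}$ is the submatrix consisting of columns $s$ to $t$ inclusive, and $\operatorname{diag}(Q_1,\ldots,Q_{\mathcal{N}})$ is block diagonal. Bars denote the fixed decomposition, not complex conjugation. *)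

(* Defs.v *)
From HB Require Import structures.
From mathcomp Require Import all_boot all_order all_algebra.
From mathcomp Require Import complex.
From mathcomp Require Import boolp classical_sets functions reals.

Set Implicit Arguments.
Unset Strict Implicit.
Unset Printing Implicit Defensive.

Import Order.TTheory GRing.Theory Num.Theory.

Local Open Scope classical_set_scope.
Local Open Scope ring_scope.

Variant base_field := Reals | Complexes.

Definition scalars (R : realType) (k : base_field) : numFieldType :=
  match k with Reals => R | Complexes => R[i] end.

Definition conj_scalar (R : realType) (k : base_field) :
    scalars R k -> scalars R k :=
  match k return scalars R k -> scalars R k with
  | Reals => fun x => x
  | Complexes => fun x => conjc x
  end.

Definition of_real (R : realType) (k : base_field) : R -> scalars R k :=
  match k return R -> scalars R k with
  | Reals => fun x => x
  | Complexes => fun x => real_complex R x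
  end.

Arguments of_real {R} k x.

Definition adjmx (R : realType) (k : base_field) (m n : nat)
    (M : 'M[scalars R k]_(m, n)) : 'M[scalars R k]_(n, m) :=
  map_mx (@conj_scalar R k) M^T.

Definition unitary_group (R : realType) (k : base_field) (d : nat) :
    set 'M[scalars R k]_d :=
  [set Q | adjmx Q *m Q = 1%:M].

(* The library's [eigenspace] consists of row vectors [u] with [u *m N = a *: u],
   so the space of column eigenvectors of [M] is that of [M^T], transposed;
   see [col_eigenspaceP]. *)
Definition col_eigenspace (K : fieldType) (n : nat) (M : 'M[K]_n) (a : K) :
    'M[K]_n :=
  eigenspace M^T a.

Lemma col_eigenspaceP (K : fieldType) (n : nat) (M : 'M[K]_n) (a : K)
    (v : 'cV[K]_n) :
  reflect (M *m v = a *: v) (v^T <= col_eigenspace M a)%MS.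
Proof.
apply: (iffP eigenspaceP); rewrite -trmx_mul -linearZ /=.
  exact: trmx_inj.
by move->.
Qed.

(* In the definitions below [conform_mx 0] only transports a matrix along a
   numerical equality between dimensions such as [r + (n - r) = n]; its default
   value 0 is reached only when the dimensions differ. In [svd_map] the equality
   is [\sum_i m_ i + (n - r) = n]: the multiplicities of the positive
   eigenvalues of [A^*A] add up to the rank of [A]. *)

(* The [m x n] matrix diag(s_1, ..., s_r, 0, ..., 0), for [r <= m] and
   [r <= n]. *)
Definition sv_mx (R : realType) (m n r : nat) (s : 'rV[R]_r) : 'M[R]_(m, n) :=
  conform_mx 0
    (block_mx (diag_mx s) 0 0 0 : 'M[R]_(r + (m - r), r + (n - r))).

(* Columns 1 to [r], and [r + 1] to [n], for [r <= n]. *)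
Definition first_cols (K : fieldType) (m n r : nat) (M : 'M[K]_(m, n)) :
    'M[K]_(m, r) :=
  lsubmx (conform_mx 0 M : 'M[K]_(m, r + (n - r))).

Definition last_cols (K : fieldType) (m n r : nat) (M : 'M[K]_(m, n)) :
    'M[K]_(m, n - r) :=
  rsubmx (conform_mx 0 M : 'M[K]_(m, r + (n - r))).

Definition svd_triple (R : realType) (k : base_field) (m n : nat) : Type :=
  ('M[scalars R k]_m * 'M[R]_(m, n) * 'M[scalars R k]_n)%type.

Definition SVDs (R : realType) (k : base_field) (m n : nat)
    (A : 'M[scalars R k]_(m, n)) : set (svd_triple R k m n) :=
  [set T | let: (U, D, V) := T in
    [/\ unitary_group U, unitary_group V,
        A = U *m map_mx (of_real k) D *m adjmx V
      & exists s : 'rV[R]_(\rank A),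
          [/\ forall i j : 'I_(\rank A), (i <= j)%N -> s 0 j <= s 0 i,
              forall i, 0 < s 0 i
            & D = sv_mx m n s] ] ].

Definition param (R : realType) (k : base_field) (p : nat) (m_ : 'I_p -> nat)
    (d d' : nat) : Type :=
  ((forall i : 'I_p, 'M[scalars R k]_(m_ i)) *
   'M[scalars R k]_d * 'M[scalars R k]_d')%type.

Definition param_group (R : realType) (k : base_field) (p : nat)
    (m_ : 'I_p -> nat) (d d' : nat) : set (param R k m_ d d') :=
  [set Q | [/\ forall i, unitary_group (Q.1.1 i),
               unitary_group Q.1.2 & unitary_group Q.2] ].

Definition svd_map (R : realType) (k : base_field) (m n r p : nat)
    (A : 'M[scalars R k]_(m, n)) (s : 'rV[R]_r) (Ubar : 'M[scalars R k]_m)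
    (Vbar : 'M[scalars R k]_n) (m_ : 'I_p -> nat)
    (Q : param R k m_ (n - r) (m - r)) : svd_triple R k m n :=
  let: (Qs, QN, QN') := Q in
  let V := Vbar *m conform_mx 0 (block_mx (\mxdiag_(i < p) Qs i) 0 0 QN) in
  let Ul := A *m first_cols r V
              *m invmx (map_mx (of_real k) (diag_mx s)) in
  let Ur := last_cols r Ubar *m QN' in
  (conform_mx 0 (row_mx Ul Ur), sv_mx m n s, V).

(* Main.v *)
Require Import Defs.
From HB Require Import structures.
From mathcomp Require Import all_boot all_order all_algebra.
From mathcomp Require Import complex.
From mathcomp Require Import boolp classical_sets functions reals.

Set Implicit Arguments.
Unset Strict Implicit.
Unset Printing Implicit Defensive.

Import Order.TTheory GRing.Theory Num.Theory.

Local Open Scope classical_set_scope.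
Local Open Scope ring_scope.

(** Write [S] for the fixed matrix of singular values, [D] for its invertible
    leading block diag(sigma), and [U], [V] for the fixed unitary factors.

    Any two decompositions of [A] have the same singular values. Indeed
    [A^*A = V diag(sigma^2, 0) V^*], so the number of [j] with [sigma_j^2 = a]
    is, for each [a > 0], the dimension of the eigenspace of [A^*A] at [a]
    ([rank_gram_eigenspace]). Two nonincreasing sequences with the same
    multiplicities coincide ([nonincreasing_eq_sig1]), so the squares are
    [lambda_1] repeated [m_1] times, then [lambda_2] repeated [m_2] times, and
    so on. In particular the [m_i] add up to the rank [r], and both [D] and
    [D^2] are scalar on each of the consecutive blocks of sizes [m_i]
    ([block_svd_spectrum]).

    It remains to find all the decompositions [A = U' S V'^*] with this [S]. Put
    [W = V^*V'] and [W' = U^*U'], which are unitary. Equating the two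
    decompositions gives [S W = W' S], and, on taking adjoints,
    [S^* W' = W S^*]. Since [D] is invertible, these equations kill the
    off-diagonal blocks of [W] and [W'], and for the leading blocks [X] and [X']
    they say [D X = X' D] and [D X' = X D] ([block_svd_transition]). So [X]
    commutes with [D^2]. As the [lambda_i] are distinct, [X] is block diagonal
    ([comm_diag_mx_mxdiag]), whence it commutes with [D] too and [X' = X]. The
    decompositions are thus
      [(U diag(Q_1, .., Q_p, Q_N'), S, V diag(Q_1, .., Q_p, Q_N))],
    and conversely each such triple is one ([block_svd_rotate]). The map of the
    theorem produces exactly this triple, because
    [A V_1 Q D^-1 = U_1 D Q D^-1 = U_1 Q] for [Q = diag(Q_1, .., Q_p)], where
    [U_1] and [V_1] are the first [r] columns of [U] and [V]
    ([left_cols_of_right]); injectivity is then clear. *)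

(** * Block diagonal matrices *)

Lemma mul_mxdiag (K : pzSemiRingType) p (d : 'I_p -> nat)
    (B C : forall i, 'M[K]_(d i)) :
  \mxdiag_i B i *m \mxdiag_i C i = \mxdiag_i (B i *m C i).
Proof.
rewrite [X in _ *m X]/mxdiag mul_mxdiag_mxblock.
apply/eq_mxblock => i j; case: eqP => [e|_]; last by rewrite mulmx0.
by case: _ / e; rewrite !conform_mx_id.
Qed.

Lemma mxdiag_comm_diag_mx (K : comPzRingType) p (d : 'I_p -> nat)
    (B : forall i, 'M[K]_(d i)) (c : 'I_p -> K) (x : 'rV[K]_(\sum_i d i)) :
    (forall j, x 0 j = c (tagnat.sig1 j)) ->
  \mxdiag_i B i *m diag_mx x = diag_mx x *m \mxdiag_i B i.
Proof.
move=> xE; apply/matrixP => i j.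
rewrite mul_mx_diag mul_diag_mx !mxE !xE mulrC.
by case: eqP => [e|_]; [congr (c _ * _) | rewrite mxE !mulr0].
Qed.

(** Entrywise, commutation with a diagonal matrix reads
    [M a b * (x b - x a) = 0]: [M] cannot link positions whose diagonal values
    differ, that is, positions in different blocks. *)
Lemma comm_diag_mx_mxdiag (K : idomainType) p (d : 'I_p -> nat)
    (M : 'M[K]_(\sum_i d i)) (c : 'I_p -> K) (x : 'rV[K]_(\sum_i d i)) :
    injective c -> (forall j, x 0 j = c (tagnat.sig1 j)) ->
    M *m diag_mx x = diag_mx x *m M ->
  M = \mxdiag_i submxblock M i i.
Proof.
move=> c_inj xE cMx; apply/mxblockP => i j.
rewrite /mxdiag mxblockK; case: eqP => [e|/eqP neq_ij].
  by case: _ / e; rewrite conform_mx_id.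
apply/matrixP => a b; move: cMx => /matrixP.
move=> /(_ (tagnat.Rank i a) (tagnat.Rank j b)).
rewrite mul_mx_diag mul_diag_mx !mxE !xE !tagnat.Rank1K mulrC => /eqP.
rewrite -subr_eq0 -mulrBl mulf_eq0 subr_eq0 (inj_eq c_inj) eq_sym.
by rewrite (negPf neq_ij) => /eqP.
Qed.

Lemma rank_diag_mx (K : fieldType) n (x : 'rV[K]_n) :
  \rank (diag_mx x) = (\sum_j (x 0 j != 0)%R)%N.
Proof.
elim: n x => [|n IHn] x; first by rewrite big_ord0 flatmx0 mxrank0.
have -> : \rank (diag_mx x) = (\rank (diag_mx (lsubmx (x : 'rV_(1 + n))))
                             + \rank (diag_mx (rsubmx (x : 'rV_(1 + n)))))%N.
  by rewrite -rank_diag_block_mx -diag_mx_row hsubmxK.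
rewrite IHn big_ord_recl rank_rV; congr (_ + _)%N.
  congr (nat_of_bool (~~ _)); apply/eqP/eqP => [/matrixP/(_ 0 0)|x0].
    by rewrite !mxE lshift0.
  by apply/matrixP => i j; rewrite !mxE !ord1 lshift0 x0 mul0rn.
by apply: eq_bigr => j _; rewrite mxE rshift1.
Qed.

(** The kernel of [D - a], for [D] diagonal, is spanned by the unit vectors at
    the positions of [a]; similarity does not change the dimension. *)
Lemma rank_eigenspace_diag (K : fieldType) n (P' P : 'M[K]_n) (x : 'rV[K]_n)
    (a : K) :
  P' *m P = 1%:M ->
  \rank (eigenspace (P' *m diag_mx x *m P) a) = (\sum_j (x 0 j == a)%R)%N.
Proof.
move=> P'P; have [uP' uP] := mulmx1_unit P'P.
rewrite /eigenspace mxrank_ker.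
have -> : P' *m diag_mx x *m P - a%:M
    = P' *m diag_mx (\row_j (x 0 j - a)) *m P.
  have -> : \row_j (x 0 j - a) = x - const_mx a.
    by apply/rowP => j; rewrite !mxE.
  rewrite linearB /= diag_const_mx mulmxBr mulmxBl; congr (_ - _).
  by rewrite mul_mx_scalar -scalemxAl P'P scalemx1.
rewrite mxrankMfree ?row_free_unit // -mxrank_tr trmx_mul.
rewrite mxrankMfree ?row_free_unit ?unitmx_tr // mxrank_tr rank_diag_mx.
under eq_bigr do rewrite mxE subr_eq0.
rewrite -[X in (X - _)%N](card_ord n) -sum1_card.
apply/eqP; rewrite -(eqn_add2r (\sum_j (x 0 j != a)%R)) subnK; last first.
  by apply: leq_sum => j _; case: (_ == _).
by rewrite -big_split; apply/eqP/eq_bigr => j _; case: (_ == _).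
Qed.

(** * Scalars and adjoints *)

Lemma of_real_is_zmod_morphism (R : realType) (k : base_field) :
  zmod_morphism (@of_real R k).
Proof. by case: k => x y //=; rewrite rmorphB. Qed.

Lemma of_real_is_monoid_morphism (R : realType) (k : base_field) :
  monoid_morphism (@of_real R k).
Proof. by case: k; split=> [|x y] //=; rewrite ?rmorph1 ?rmorphM. Qed.

HB.instance Definition _ (R : realType) (k : base_field) :=
  GRing.isZmodMorphism.Build R (scalars R k) (@of_real R k)
    (@of_real_is_zmod_morphism R k).
HB.instance Definition _ (R : realType) (k : base_field) :=
  GRing.isMonoidMorphism.Build R (scalars R k) (@of_real R k)
    (@of_real_is_monoid_morphism R k).

Lemma conj_scalar_is_zmod_morphism (R : realType) (k : base_field) :
  zmod_morphism (@conj_scalar R k).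
Proof. by case: k => x y //; exact: (rmorphB (@conjc R)). Qed.

Lemma conj_scalar_is_monoid_morphism (R : realType) (k : base_field) :
  monoid_morphism (@conj_scalar R k).
Proof.
case: k; split=> [|x y] //.
  exact: (rmorph1 (@conjc R)).
exact: (rmorphM (@conjc R)).
Qed.

HB.instance Definition _ (R : realType) (k : base_field) :=
  GRing.isZmodMorphism.Build (scalars R k) (scalars R k) (@conj_scalar R k)
    (@conj_scalar_is_zmod_morphism R k).
HB.instance Definition _ (R : realType) (k : base_field) :=
  GRing.isMonoidMorphism.Build (scalars R k) (scalars R k) (@conj_scalar R k)
    (@conj_scalar_is_monoid_morphism R k).

Lemma conj_scalarK (R : realType) (k : base_field) :
  involutive (@conj_scalar R k).
Proof. by case: k => x //=; rewrite conjcK. Qed.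

Lemma conj_of_real (R : realType) (k : base_field) (x : R) :
  conj_scalar (of_real k x) = of_real k x.
Proof. by case: k => //; exact: conjc_real. Qed.

Section Adjoint.
Variables (R : realType) (k : base_field).
Local Notation K := (scalars R k).

Lemma adjmxK m n (M : 'M[K]_(m, n)) : adjmx (adjmx M) = M.
Proof. by apply/matrixP => i j; rewrite !mxE conj_scalarK. Qed.

Lemma adjmx_mul m n q (M : 'M[K]_(m, n)) (N : 'M[K]_(n, q)) :
  adjmx (M *m N) = adjmx N *m adjmx M.
Proof. by rewrite /adjmx trmx_mul map_mxM. Qed.

Lemma adjmx0 m n : adjmx (0 : 'M[K]_(m, n)) = 0.
Proof. by rewrite /adjmx trmx0 map_mx0. Qed.

Lemma adjmx_block m1 m2 n1 n2 (a : 'M[K]_(m1, n1)) (b : 'M[K]_(m1, n2))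
    (c : 'M[K]_(m2, n1)) (d : 'M[K]_(m2, n2)) :
  adjmx (block_mx a b c d)
  = block_mx (adjmx a) (adjmx c) (adjmx b) (adjmx d).
Proof. by rewrite /adjmx tr_block_mx map_block_mx. Qed.

Lemma adjmx_diag_real n (s : 'rV[R]_n) :
  adjmx (diag_mx (map_mx (of_real k) s)) = diag_mx (map_mx (of_real k) s).
Proof.
rewrite /adjmx tr_diag_mx map_diag_mx; congr diag_mx.
by apply/rowP => j; rewrite !mxE /= conj_of_real.
Qed.

Lemma unitary_mulmx_adj n (U : 'M[K]_n) :
  unitary_group U -> U *m adjmx U = 1%:M.
Proof. exact: mulmx1C. Qed.

Lemma unitary_mul n (U W : 'M[K]_n) :
  unitary_group U -> unitary_group W -> unitary_group (U *m W).
Proof.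
move=> uU uW; rewrite /unitary_group /= adjmx_mul mulmxA.
by rewrite -(mulmxA _ _ U) uU mulmx1.
Qed.

Lemma unitary_adj n (U : 'M[K]_n) :
  unitary_group U -> unitary_group (adjmx U).
Proof. by move=> uU; rewrite /unitary_group /= adjmxK unitary_mulmx_adj. Qed.

Lemma unitary_block n1 n2 (X : 'M[K]_n1) (Y : 'M[K]_n2) :
  unitary_group (block_mx X 0 0 Y) <-> unitary_group X /\ unitary_group Y.
Proof.
rewrite /unitary_group /= adjmx_block !adjmx0 mulmx_block.
rewrite !mulmx0 !mul0mx !addr0 !add0r scalar_mx_block.
split=> [/eq_block_mx[]|[-> ->]] //.
Qed.

Lemma adjmx_mxdiag p (d : 'I_p -> nat) (Q : forall i, 'M[K]_(d i)) :
  adjmx (\mxdiag_i Q i) = \mxdiag_i adjmx (Q i).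
Proof.
rewrite /adjmx tr_mxdiag; apply/matrixP => i j; rewrite !mxE.
case: eqP => [e|_]; last by rewrite !mxE rmorph0.
rewrite -(map_mx0 (@conj_scalar R k)) -map_conform_mx.
by rewrite mxE map_mx0.
Qed.

Lemma unitary_mxdiag p (d : 'I_p -> nat) (Q : forall i, 'M[K]_(d i)) :
  unitary_group (\mxdiag_i Q i) <-> forall i, unitary_group (Q i).
Proof.
rewrite /unitary_group /= adjmx_mxdiag mul_mxdiag -(mxdiagZ 1).
by rewrite -eq_mxdiagP.
Qed.

End Adjoint.

(** * Nonincreasing sequences with prescribed multiplicities *)

Lemma decreasing_inj (R : realType) p (lambda : 'I_p -> R) :
  (forall i j : 'I_p, (i < j)%N -> lambda j < lambda i) -> injective lambda.
Proof.
move=> l_decr i j e; apply/val_inj; case: (ltngtP i j) => // /l_decr.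
  by rewrite e ltxx.
by rewrite e ltxx.
Qed.

Lemma sum_sig1_eq p (d : 'I_p -> nat) (i : 'I_p) :
  (\sum_(j < \sum_i d i) (tagnat.sig1 j == i))%N = d i.
Proof.
rewrite (reindex _ tagnat.rank_bij_on) /=.
under eq_bigr do rewrite tagnat.rankE tagnat.Rank1K.
rewrite -(@sig_big_dep _ _ _ _ _ predT (fun _ => predT)
            (fun i' _ => nat_of_bool (i' == i))) /=.
rewrite (bigD1 i) //= [X in (_ + X)%N]big1 => [|i' /negPf ni]; last first.
  by rewrite big1 // => j _; rewrite ni.
by rewrite eqxx sum1_card card_ord addn0.
Qed.

(** The sequence [x] and the one listing each [lambda i] with multiplicity
    [d i], block after block, are sorted permutations of each other. Comparing
    their lengths yields [e]: for singular values it says that the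
    multiplicities add up to the rank. *)
Lemma nonincreasing_eq_sig1 (R : realType) r p (x : 'I_r -> R)
    (lambda : 'I_p -> R) (d : 'I_p -> nat) :
    (forall i j : 'I_r, (i <= j)%N -> x j <= x i) ->
    (forall i j : 'I_p, (i < j)%N -> lambda j < lambda i) ->
    (forall j, exists i, lambda i = x j) ->
    (forall i, (\sum_j (x j == lambda i)%R)%N = d i) ->
  exists e : r = (\sum_i d i)%N,
    forall j, x j = lambda (tagnat.sig1 (cast_ord e j)).
Proof.
move=> x_decr l_decr x_l count_x.
have l_noninc (i j : 'I_p) : (i <= j)%N -> lambda j <= lambda i.
  by rewrite leq_eqVlt => /predU1P[/val_inj->|/l_decr/ltW].
have l_inj := decreasing_inj l_decr.
pose y (j : 'I_(\sum_i d i)) := lambda (tagnat.sig1 j).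
have sorted_codom t (z : 'I_t -> R) :
    (forall i j : 'I_t, (i <= j)%N -> z j <= z i) -> sorted >=%O (codom z).
  move=> z_decr; rewrite sorted_map.
  apply: (@sub_sorted _ (fun i j : 'I_t => (i <= j)%N)).
    by move=> i j; apply: z_decr.
  by have := iota_sorted 0 t; rewrite -val_enum_ord sorted_map.
have count_codom t (z : 'I_t -> R) a :
    count_mem a (codom z) = (\sum_j (z j == a)%R)%N.
  rewrite count_map -sum1_count big_enum_cond /= big_mkcond /=.
  by apply: eq_bigr => j _ /=; case: (_ == _).
have eq_xy : codom x = codom y.
  apply: (@sorted_eq _ >=%O); rewrite ?sorted_codom //.
  - by move=> a b c /= ba ac; apply: le_trans ac ba.
  - by move=> a b /= /andP[ab ba]; apply/le_anti/andP.
  - by move=> i j ij; apply/l_noninc/(tagnat.le_sig1 ij).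
  apply/allP => a; rewrite mem_cat => a_xy.
  have [i ->] : exists i, a = lambda i.
    case/orP: a_xy => /codomP[j ->]; last by exists (tagnat.sig1 j).
    by have [i <-] := x_l j; exists i.
  rewrite /= !count_codom count_x -(sum_sig1_eq d i); apply/eqP.
  by apply: eq_bigr => j _; rewrite /y (inj_eq l_inj).
have e : r = (\sum_i d i)%N.
  by have := congr1 size eq_xy; rewrite !size_codom !card_ord.
subst r; exists erefl => j; rewrite cast_ord_id.
by move/eq_in_map: eq_xy => /(_ j); apply; rewrite mem_enum.
Qed.

(** * Singular value decompositions in block form *)

Lemma lsubmx_mul_diag_block (K : pzSemiRingType) q a b c d
    (M : 'M[K]_(q, a + b)) (X : 'M[K]_(a, c)) (Y : 'M[K]_(b, d)) :
  lsubmx (M *m block_mx X 0 0 Y) = lsubmx M *m X.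
Proof.
by rewrite -{1}[M]hsubmxK mul_row_block !mulmx0 addr0 add0r row_mxKl.
Qed.

Section BlockSVD.
Variables (R : realType) (k : base_field) (r m1 n1 : nat).
Local Notation K := (scalars R k).
Local Notation Dg s := (diag_mx (map_mx (of_real k) s)).

(** A singular value decomposition with dimensions split at the rank [r], which
    avoids transport along [r + (n - r) = n], and with the vector of singular
    values in place of the matrix. *)
Definition block_svd (A : 'M[K]_(r + m1, r + n1)) (U : 'M[K]_(r + m1))
    (s : 'rV[R]_r) (V : 'M[K]_(r + n1)) : Prop :=
  [/\ unitary_group U, unitary_group V,
      A = U *m block_mx (Dg s) 0 0 0 *m adjmx V,
      forall i j : 'I_r, (i <= j)%N -> s 0 j <= s 0 i
    & forall i, 0 < s 0 i].

Lemma sv_diag_unit (s : 'rV[R]_r) : (forall i, 0 < s 0 i) -> Dg s \in unitmx.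
Proof.
move=> s_gt0; rewrite -map_diag_mx map_unitmx unitmxE det_diag unitfE.
by apply/prodf_neq0 => i _; rewrite gt_eqF.
Qed.

Variable A : 'M[K]_(r + m1, r + n1).

Lemma gram_block_svd U s V : block_svd A U s V ->
  adjmx A *m A
  = V *m diag_mx (row_mx (map_mx (of_real k) (\row_j s 0 j ^+ 2)) 0) *m adjmx V.
Proof.
case=> uU _ -> _ _; rewrite !adjmx_mul adjmxK !mulmxA; congr (_ *m _).
rewrite -!mulmxA; congr (_ *m _).
rewrite (mulmxA (adjmx U)) uU mul1mx adjmx_block !adjmx0 adjmx_diag_real.
rewrite mulmx_block !mulmx0 !mul0mx !addr0 mulmx_diag diag_mx_row.
congr (block_mx (diag_mx _) 0 0 _); last by rewrite linear0.
by apply/rowP => j; rewrite !mxE -rmorphM expr2.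
Qed.

Lemma rank_gram_eigenspace U s V (a : R) : block_svd A U s V -> 0 < a ->
  \rank (col_eigenspace (adjmx A *m A) (of_real k a))
  = (\sum_j (s 0 j ^+ 2 == a)%R)%N.
Proof.
move=> svdA a_gt0; have [_ uV _ _ _] := svdA.
rewrite /col_eigenspace (gram_block_svd svdA) !trmx_mul tr_diag_mx mulmxA.
rewrite rank_eigenspace_diag; last first.
  by rewrite -trmx_mul unitary_mulmx_adj ?trmx1.
rewrite big_split_ord /= [X in (_ + X)%N]big1 ?addn0.
  apply: eq_bigr => j _; rewrite row_mxEl !mxE.
  by rewrite (inj_eq (@fmorph_inj _ _ (of_real k : {rmorphism R -> K}))).
(* The zero diagonal entries of the padding do not contribute, as [a > 0]. *)
by move=> j _; rewrite row_mxEr mxE eq_sym fmorph_eq0 gt_eqF.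
Qed.

Section Spectrum.
Variables (p : nat) (lambda : 'I_p -> R) (m_ : 'I_p -> nat).
Hypothesis lambda_decr : forall i j : 'I_p, (i < j)%N -> lambda j < lambda i.
Hypothesis lambda_eigen : forall a : R,
  (exists i, lambda i = a) <->
  0 < a /\ col_eigenspace (adjmx A *m A) (of_real k a) != 0.
Hypothesis m_dim : forall i,
  m_ i = \rank (col_eigenspace (adjmx A *m A) (of_real k (lambda i))).

(** The eigenspaces of the [lambda i] determine the singular values: this gives
    both the uniqueness of the latter and the block structure of their diagonal
    matrix. *)
Lemma block_svd_spectrum U s V : block_svd A U s V ->
  exists e : r = (\sum_i m_ i)%N,
    forall j, s 0 j ^+ 2 = lambda (tagnat.sig1 (cast_ord e j)).
Proof.
move=> svdA; have [_ _ _ s_decr s_gt0] := svdA.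
have lambda_gt0 i : 0 < lambda i.
  by have [] := (lambda_eigen (lambda i)).1 (ex_intro _ i erefl).
apply: nonincreasing_eq_sig1 => //.
- by move=> i j ij; rewrite lerXn2r ?nnegrE ?s_decr // ltW.
- move=> j; apply/lambda_eigen; split; first by rewrite exprn_gt0.
  rewrite -mxrank_eq0 (rank_gram_eigenspace svdA) ?exprn_gt0 //.
  by rewrite (bigD1 j) //= eqxx.
- by move=> i; rewrite m_dim (rank_gram_eigenspace svdA).
Qed.

Lemma block_svd_uniq_sv U s V U' s' V' :
  block_svd A U s V -> block_svd A U' s' V' -> s = s'.
Proof.
move=> svdA svdA'; have [e se] := block_svd_spectrum svdA.
have [e' se'] := block_svd_spectrum svdA'.
have [_ _ _ _ s_gt0] := svdA; have [_ _ _ _ s'_gt0] := svdA'.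
apply/rowP => j; apply/eqP; rewrite -(@eqrXn2 _ 2) ?ltW //.
by rewrite se se' (eq_irrelevance e e').
Qed.

End Spectrum.

(** The factor [X] acts on both sides and cancels because it commutes with the
    singular values; [Y] and [Z] only meet the zero blocks. *)
Lemma block_svd_rotate U s V X Y Z : block_svd A U s V ->
    unitary_group X -> unitary_group Y -> unitary_group Z ->
    X *m Dg s = Dg s *m X ->
  block_svd A (U *m block_mx X 0 0 Z) s (V *m block_mx X 0 0 Y).
Proof.
case=> uU uV eA s_decr s_gt0 uX uY uZ XD.
split=> //; try by apply: unitary_mul => //; apply/unitary_block.
rewrite eA adjmx_mul adjmx_block !adjmx0 !mulmxA; congr (_ *m _).
rewrite -!mulmxA; congr (_ *m _).
rewrite !mulmx_block !(mulmx0, mul0mx, addr0).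
by rewrite mulmxA XD -mulmxA unitary_mulmx_adj // mulmx1.
Qed.

(** On the first [r] columns, [A V = U S] reads [A V_1 = U_1 D]. Hence
    [A V_1 X D^-1 = U_1 D X D^-1], and [D] cancels as [X] commutes with it. *)
Lemma left_cols_of_right U s V (X : 'M[K]_r) (Y : 'M[K]_n1) :
    block_svd A U s V ->
    X *m Dg s = Dg s *m X ->
  A *m lsubmx (V *m block_mx X 0 0 Y) *m invmx (Dg s) = lsubmx U *m X.
Proof.
case=> uU uV eA s_decr s_gt0 XD.
have -> : A *m lsubmx (V *m block_mx X 0 0 Y) = lsubmx U *m Dg s *m X.
  rewrite lsubmx_mul_diag_block mulmxA mulmx_lsub; congr (_ *m _).
  by rewrite eA -mulmxA uV mulmx1 lsubmx_mul_diag_block.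
by rewrite -(mulmxA _ _ X) -XD mulmxA mulmxK // sv_diag_unit.
Qed.

(** The transition matrices [W = V^*V'] and [W' = U^*U'] intertwine both the
    matrix [S] of singular values and its adjoint: [S W = W' S] and
    [S^* W' = W S^*]. The invertible block of [S] then makes the off-diagonal
    blocks of [W] and [W'] vanish. *)
Lemma block_svd_transition U s V U' V' :
    block_svd A U s V -> block_svd A U' s V' ->
  exists X X' Y Z, [/\ V' = V *m block_mx X 0 0 Y, U' = U *m block_mx X' 0 0 Z,
    Dg s *m X = X' *m Dg s & Dg s *m X' = X *m Dg s].
Proof.
case=> uU uV eA _ s_gt0 [uU' uV' eA' _ _].
have uD := sv_diag_unit s_gt0.
pose W := adjmx V *m V'; pose W' := adjmx U *m U'.
pose S : 'M[K]_(r + m1, r + n1) := block_mx (Dg s) 0 0 0.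
have eV : V' = V *m W by rewrite mulmxA unitary_mulmx_adj ?mul1mx.
have eU : U' = U *m W' by rewrite mulmxA unitary_mulmx_adj ?mul1mx.
have uW : unitary_group W by apply: unitary_mul => //; apply: unitary_adj.
have uW' : unitary_group W' by apply: unitary_mul => //; apply: unitary_adj.
have SW : S *m W = W' *m S.
  have : adjmx U *m A *m V' = S *m W by rewrite eA !mulmxA uU mul1mx.
  by move=> <-; rewrite /W' eA' !mulmxA -(mulmxA _ _ V') uV' mulmx1.
clearbody W W'.
(* Unitarity turns the adjoint of [SW] into a second intertwining relation. *)
have SW' : adjmx S *m W' = W *m adjmx S.
  have /(congr1 (mulmx W)) := congr1 (@adjmx _ _ _ _) SW.
  rewrite !adjmx_mul !mulmxA unitary_mulmx_adj // mul1mx => eS.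
  by rewrite {1}eS -mulmxA uW' mulmx1.
move: SW SW'; rewrite /S adjmx_block !adjmx0 adjmx_diag_real.
rewrite -{1 2}[W]submxK -{1 2}[W']submxK !mulmx_block.
rewrite !(mulmx0, mul0mx, addr0).
case/eq_block_mx => SX /(canRL (mulKmx uD)); rewrite mulmx0 => Wur.
move=> /esym/(canRL (mulmxK uD)); rewrite mul0mx => W'dl _.
case/eq_block_mx => SX' /(canRL (mulKmx uD)); rewrite mulmx0 => W'ur.
move=> /esym/(canRL (mulmxK uD)); rewrite mul0mx => Wdl _.
exists (ulsubmx W), (ulsubmx W'), (drsubmx W), (drsubmx W').
split=> //; first by rewrite -{1}Wur -Wdl submxK.
by rewrite -{1}W'ur -W'dl submxK.
Qed.

End BlockSVD.

(** * The parametrization *)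

Lemma sv_mx_block (R : realType) (r m1 n1 : nat) (s : 'rV[R]_r) :
  sv_mx (r + m1) (r + n1) s = block_mx (diag_mx s) 0 0 0.
Proof.
rewrite /sv_mx; move: (r + m1 - r)%N (addKn r m1) => m2 em; subst m2.
move: (r + n1 - r)%N (addKn r n1) => n2 en; subst n2.
exact: conform_mx_id.
Qed.

Lemma sv_mx_inj (R : realType) (r m1 n1 : nat) :
  injective (@sv_mx R (r + m1) (r + n1) r).
Proof.
move=> s t; rewrite !sv_mx_block => /eq_block_mx[/matrixP st _ _ _].
by apply/rowP => j; have := st j j; rewrite !mxE eqxx.
Qed.

Lemma SVDs_block (R : realType) (k : base_field) (r m1 n1 : nat)
    (A : 'M[scalars R k]_(r + m1, r + n1)) U D V : \rank A = r ->
  SVDs A (U, D, V) <->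
  exists2 s, block_svd A U s V & D = sv_mx (r + m1) (r + n1) s.
Proof.
move=> rankA; rewrite /SVDs /=; move: (\rank A) rankA => q e; subst q.
have mapD s : map_mx (of_real k) (sv_mx (r + m1) (r + n1) s)
    = block_mx (diag_mx (map_mx (of_real k) s)) 0 0 0.
  by rewrite sv_mx_block map_block_mx map_diag_mx !map_mx0.
split=> [[uU uV eA [s [s_decr s_gt0 eD]]]|[s [uU uV eA s_decr s_gt0] eD]].
  by exists s => //; split=> //; rewrite eA eD mapD.
by split=> //; [rewrite eD mapD | exists s].
Qed.

Theorem corollary4p4 (R : realType) (k : base_field) (m n r p : nat)
    (A : 'M[scalars R k]_(m, n)) (rankA : \rank A = r)
    (lambda : 'I_p -> R) (m_ : 'I_p -> nat)
    (lambda_decr : forall i j : 'I_p, (i < j)%N -> lambda j < lambda i)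
    (lambda_eigen : forall a : R,
       (exists i, lambda i = a) <->
       0 < a /\ col_eigenspace (adjmx A *m A) (of_real k a) != 0)
    (m_dim : forall i,
       m_ i = \rank (col_eigenspace (adjmx A *m A) (of_real k (lambda i))))
    (Ubar : 'M[scalars R k]_m) (Vbar : 'M[scalars R k]_n) (sigma : 'rV[R]_r)
    (svdA : SVDs A (Ubar, sv_mx m n sigma, Vbar)) :
  set_bij (param_group (m_ := m_) (d := n - r) (d' := m - r))
          (SVDs A)
          (svd_map A sigma Ubar Vbar (m_ := m_)).
Proof.
(* Every transport becomes trivial once [m] and [n] are replaced with [r + m1]
   and [r + n1], and [r] with the sum of the multiplicities. *)
have em : (r + (m - r))%N = m by rewrite subnKC // -rankA rank_leq_row.
have en : (r + (n - r))%N = n by rewrite subnKC // -rankA rank_leq_col.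
rewrite /svd_map /first_cols /last_cols.
move: (m - r)%N (n - r)%N em en => m1 n1 em en; subst m n.
have [s bsvd /sv_mx_inj es] := (SVDs_block _ _ _ rankA).1 svdA; subst s.
have [e sigmaE] := block_svd_spectrum lambda_decr lambda_eigen m_dim bsvd.
subst r.
have {}sigmaE j : sigma 0 j ^+ 2 = lambda (tagnat.sig1 j).
  by rewrite sigmaE cast_ord_id.
have [uU uV eA s_decr s_gt0] := bsvd.
pose D := diag_mx (map_mx (of_real k) sigma).
have comm_D (Q : forall i, 'M[scalars R k]_(m_ i)) :
    \mxdiag_i Q i *m D = D *m \mxdiag_i Q i.
  apply: (@mxdiag_comm_diag_mx _ _ _ _
            (fun i => of_real k (Num.sqrt (lambda i)))).
  by move=> j; rewrite mxE -sigmaE sqrtr_sqr ger0_norm // ltW.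
(* The map of the theorem, rewritten as the action of the group on the pair
   [(Ubar, Vbar)] by right multiplication. *)
pose f (Q : param R k m_ n1 m1) : svd_triple R k _ _ :=
  (Ubar *m block_mx (\mxdiag_i Q.1.1 i) 0 0 Q.2,
   sv_mx (\sum_i m_ i + m1) (\sum_i m_ i + n1) sigma,
   Vbar *m block_mx (\mxdiag_i Q.1.1 i) 0 0 Q.1.2).
rewrite [X in set_bij _ _ X](_ : _ = f); last first.
  apply/funext => -[[Qs QN] QN']; rewrite /f /= !conform_mx_id map_diag_mx.
  rewrite (left_cols_of_right _ bsvd) //.
  rewrite -{3}(hsubmxK Ubar) mul_row_block.
  by rewrite !mulmx0 addr0 add0r.
split.
- move=> [[Qs QN] QN'] [/= uQs uQN uQN'].
  apply/(SVDs_block _ _ _ rankA); exists sigma => //.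
  by apply: block_svd_rotate => //; apply/unitary_mxdiag.
- have cancel_unitary q (W : 'M[scalars R k]_q) : unitary_group W ->
      injective (mulmx W : 'M_q -> 'M_q).
    move=> uW; apply: (can_inj (g := mulmx (adjmx W))) => X.
    by rewrite mulmxA uW mul1mx.
  move=> [[Qs QN] QN'] [[Ps PN] PN'] _ _ [] /=.
  move=> /(cancel_unitary _ _ uU)/eq_block_mx[_ _ _ ->].
  move=> /(cancel_unitary _ _ uV)/eq_block_mx[/eq_mxdiagP QP _ _ ->].
  by have -> : Qs = Ps by apply: functional_extensionality_dep.
move=> [[U S] V] /(SVDs_block _ _ _ rankA)[s bsvd' ->].
have es := block_svd_uniq_sv lambda_decr lambda_eigen m_dim bsvd bsvd'.
subst s.
have [X [X' [Y [Z [eV eU DX DX']]]]] := block_svd_transition bsvd bsvd'.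
have uD := sv_diag_unit k s_gt0.
pose D2 := diag_mx
  (\row_(j < \sum_i m_ i) of_real k (lambda (tagnat.sig1 j))).
have XD2 : X *m D2 = D2 *m X.
  have <- : D *m D = D2.
    rewrite mulmx_diag; congr diag_mx.
    by apply/rowP => j; rewrite !mxE -sigmaE -rmorphM expr2.
  by rewrite mulmxA -DX' -!mulmxA DX.
have eX : X = \mxdiag_i submxblock X i i.
  apply: (@comm_diag_mx_mxdiag _ _ _ _
            (fun i => of_real k (lambda i)) _ _ _ XD2).
    by move=> i j /fmorph_inj/(decreasing_inj lambda_decr).
  by move=> j; rewrite mxE.
have eX' : X' = X.
  by apply: (can_inj (mulmxK uD)); rewrite -DX eX comm_D.
have [_ uV' _ _ _] := bsvd'; have [uU' _ _ _ _] := bsvd'.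
have /unitary_block[uX uY] : unitary_group (block_mx X 0 0 Y).
  have -> : block_mx X 0 0 Y = adjmx Vbar *m V by rewrite eV mulmxA uV mul1mx.
  by apply: unitary_mul => //; apply: unitary_adj.
have /unitary_block[_ uZ] : unitary_group (block_mx X' 0 0 Z).
  have -> : block_mx X' 0 0 Z = adjmx Ubar *m U by rewrite eU mulmxA uU mul1mx.
  by apply: unitary_mul => //; apply: unitary_adj.
exists (fun i => submxblock X i i, Y, Z).
  by split=> //=; apply/unitary_mxdiag; rewrite -eX.
by rewrite /f /= -eX eV eU eX'.
Qed.
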